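(* Let $L=1$ (a single source) and consider $N$ elements with positions in $[0,D]$. The D-optimal design, i.e. the design maximizing $\log\det\mathbf{F}=\log F(\theta;\{p_n\})$ over $(p_1,\dots,p_N)\in[0,D]^N$, places the antennas at the two endpoints with multiplicities proportional to $N$: $$p_n^*\in\{0,D\},\qquad n=1,\dots,N.$$ This maximizes the Fisher information $$F(\theta;\{p_n\})=\frac{8\pi^2N_pP_sN}{\sigma^2\lambda^2}\cos^2\theta\cdot\mu_2(\{p_n\}).$$
   Context: $\lambda>0$ is the wavelength, $D>0$ the length of the deployment region, $\sigma^2>0$ the noise power, $P_s>0$ the source power, $N_p\ge 1$ the number of snapshots, and $\theta\in(-\pi/2,\pi/2)$ the source angle. For positions $p_1,\dots,p_N$, $\bar p=\frac1N\sum_np_n$ and $\mu_2(\{p_n\})=\frac1N\sum_{n=1}^N(p_n-\bar p)^2$. For $L=1$ the Fisher information matrix is the scalar $F(\theta;\{p_n\})$ displayed in the claim. For even $N$, the multiplicities are $N/2$ elements at $0$ and $N/2$ elements at $D$. *)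

(* Defs.v *)
(* MathComp-Analysis *)
From HB Require Import structures.
From mathcomp Require Export all_boot all_order all_algebra.
From mathcomp Require Export all_classical all_reals all_analysis.
Export Order.TTheory GRing.Theory Num.Theory numFieldNormedType.Exports.

Set Implicit Arguments.
Unset Strict Implicit.
Unset Printing Implicit Defensive.

Local Open Scope classical_set_scope.
Local Open Scope ring_scope.

Definition is_maximizer (T : Type) (d : Order.disp_t) (V : porderType d)
    (A : set T) (f : T -> V) (x : T) : Prop :=
  A x /\ forall y, A y -> (f y <= f x)%O.

Section Design.
Variables (R : realType) (N : nat).
Implicit Types p : 'I_N -> R.

Definition deployment (D : R) : set ('I_N -> R) :=
  [set p | forall n, p n \in `[0, D]].

Definition mean p : R := N%:R^-1 * \sum_(n < N) p n.

Definition mu2 p : R := N%:R^-1 * \sum_(n < N) (p n - mean p) ^+ 2.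

(* The noise power is the single parameter sigma2. *)
Definition fisher_info (Np : nat) (lambda sigma2 Ps theta : R) p : R :=
  (8 * pi ^+ 2 * Np%:R * Ps * N%:R) / (sigma2 * lambda ^+ 2)
  * cos theta ^+ 2 * mu2 p.

Definition fisher_mx (Np : nat) (lambda sigma2 Ps theta : R) p : 'M[R]_1 :=
  (fisher_info Np lambda sigma2 Ps theta p)%:M.

(* The extended logarithm lne has log 0 = -oo, whereas ln 0 = 0 would make a
   design with singular information matrix spuriously good. *)
Definition log_det (L : nat) (F : 'M[R]_L) : \bar R := lne (\det F)%:E.

Definition D_optimal (L : nat) (D : R) (F : ('I_N -> R) -> 'M[R]_L) p : Prop :=
  is_maximizer (deployment D) (fun q => log_det (F q)) p.

Definition at_endpoints (D : R) p : Prop := forall n, p n = 0 \/ p n = D.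

Definition multiplicity p (x : R) : nat := #|[set n : 'I_N | p n == x]%SET|.

End Design.

(* Main.v *)
(* Up to a positive factor the determinant is the variance of the positions,
   a convex quadratic function of each single position, strictly so when
   N >= 2. Moving an interior position to one of the two endpoints therefore
   increases the variance, so only the finitely many endpoint designs compete.
   With k elements at D the variance is D^2 k (N - k) / N^2, which for even N
   is largest exactly when k = N / 2. *)
Require Import Defs.
From mathcomp Require Import ring lra zify.

Local Open Scope classical_set_scope.
Local Open Scope ring_scope.

(** Maximality depends only on the preorder that the objective induces on designs. The codomains may
    differ, so an objective in [\bar R] can be traded for one in [R]. *)
Lemma eq_maximizers (T : Type) (d d' : Order.disp_t) (V : porderType d)
    (W : porderType d') (A : set T) (f : T -> V) (g : T -> W) (x : T) :
    (forall x y, (f x <= f y)%O = (g x <= g y)%O) ->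
  is_maximizer A f x <-> is_maximizer A g x.
Proof.
by move=> fg; split=> -[Ax max_x]; split=> // y /max_x; rewrite fg.
Qed.

(** AM-GM for [b] and [N - b], whose sum is fixed; the equality case is [b = N - b]. *)
Lemma mul_subn_half (N b : nat) : ~~ odd N -> (b <= N)%N ->
  (b * (N - b) <= N./2 * (N - N./2) ?= iff (b == N./2))%N.
Proof.
move=> evenN leBN; have [/= leAGM eqAGM] := nat_AGM2 b (N - b).
have bE : (b == N./2) = (b == N - b)%N by apply/eqP/eqP; lia.
have hE : (4 * (N./2 * (N - N./2)) = (b + (N - b)) ^ 2)%N.
  rewrite subnKC// -[in RHS](even_halfK evenN).
  have -> : (N - N./2 = N./2)%N by lia.
  by rewrite -muln2; ring.
split; first by rewrite -(leq_pmul2l (isT : 0 < 4)%N) hE.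
by rewrite bE -eqAGM -hE eqn_pmul2l.
Qed.

Section Variance.
Set Implicit Arguments.
Unset Strict Implicit.
Variables (R : realType) (N : nat).
Implicit Types (p : 'I_N -> R) (D : R) (A : {set 'I_N}).

(** This form is free of the mean: moving one position changes a single term in each of the two
    sums. *)
Lemma mu2E p : (0 < N)%N ->
  mu2 p = (N%:R * \sum_n p n ^+ 2 - (\sum_n p n) ^+ 2) / N%:R ^+ 2.
Proof.
move=> N_gt0; have NN0 : N%:R != 0 :> R by rewrite pnatr_eq0 -lt0n.
rewrite /mu2.
rewrite (eq_bigr (fun n => p n ^+ 2 - 2 * mean p * p n + mean p ^+ 2)).
  rewrite !big_split/= sumrN -mulr_sumr sumr_const card_ord -mulr_natr /mean.
  by field.
by move=> n _; ring.
Qed.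

Lemma mu2_ge0 p : 0 <= mu2 p.
Proof. by rewrite mulr_ge0 ?invr_ge0 ?sumr_ge0// => n _; rewrite sqr_ge0. Qed.

Lemma mu2_move_to_endpoint D p n : (1 < N)%N -> 0 < p n < D ->
  exists2 e, e = 0 \/ e = D & mu2 p < mu2 [eta p with n |-> e].
Proof.
move=> N_gt1 /andP[pn_gt0 pn_ltD].
have N_gt0 : (0 < N)%N by exact: ltnW.
have N2_gt0 : 0 < N%:R ^+ 2 :> R by rewrite exprn_gt0// ltr0n.
set S := \sum_(i | i != n) p i.
(* The increment of [N ^ 2 * mu2] is a quadratic in [e] that vanishes at [e = p n], hence this
   factorization. *)
have ltE e : (mu2 p < mu2 [eta p with n |-> e]) =
    (0 < (e - p n) * ((N%:R - 1) * (e + p n) - 2 * S)).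
  have splitE (g : R -> R) (q : 'I_N -> R) :
      (forall i, i != n -> q i = p i) ->
      \sum_i g (q i) = g (q n) + \sum_(i | i != n) g (p i).
    move=> qE; rewrite (bigD1 n)//=; congr (_ + _).
    by apply: eq_bigr => i /qE->.
  set q := [eta p with n |-> e].
  have qE i : i != n -> q i = p i by rewrite /q/= => /negPf->.
  have qn : q n = e by rewrite /q/= eqxx.
  rewrite !mu2E// ltr_pM2r ?invr_gt0// -subr_gt0.
  rewrite !(splitE (fun x => x ^+ 2) q)// !(splitE id q)//.
  rewrite !(splitE (fun x => x ^+ 2) p)// !(splitE id p)// qn.
  by rewrite -/S; congr (0 < _); ring.
have N1_gt0 : 0 < N%:R - 1 :> R by rewrite subr_gt0 ltr1n.
(* The sign of the second factor at [e = 0] decides. If it is negative, both factors are negative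
   there; otherwise [e = D] adds [(N - 1) * D > 0] to it and makes both positive. *)
have [lt2S|le2S] := ltP ((N%:R - 1) * p n) (2 * S).
  by exists 0; [left | rewrite ltE; nra].
by exists D; [right | rewrite ltE; apply: mulr_gt0; nra].
Qed.

(** Indexing the endpoint designs by the set of elements at [D] makes the candidates a finite
    type. *)
Definition endpoint_design D A : 'I_N -> R := fun n => if n \in A then D else 0.

Lemma endpoint_design_deployment D A : 0 < D ->
  deployment D (endpoint_design D A).
Proof.
move=> D_gt0 n; rewrite /endpoint_design in_itv/=.
by case: ifP; rewrite lexx (ltW D_gt0).
Qed.

Lemma at_endpoints_design D A : at_endpoints D (endpoint_design D A).
Proof. by move=> n; rewrite /endpoint_design; case: ifP; [right | left]. Qed.

Lemma at_endpointsE D p : at_endpoints D p ->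
  p = endpoint_design D [set n | p n == D]%SET.
Proof.
move=> pE; apply/funext => n; rewrite /endpoint_design inE.
by case: (eqVneq (p n) D) (pE n) => [//|pnD [//|pnE]]; rewrite pnE eqxx in pnD.
Qed.

Lemma multiplicity_design_r D A : D != 0 ->
  multiplicity (endpoint_design D A) D = #|A|.
Proof.
move=> D_neq0; apply: eq_card => n; rewrite inE /endpoint_design.
by case: ifP; rewrite ?eqxx// eq_sym (negPf D_neq0).
Qed.

Lemma multiplicity_design_l D A : D != 0 ->
  multiplicity (endpoint_design D A) 0 = (N - #|A|)%N.
Proof.
move=> D_neq0; rewrite -[X in (X - _)%N]card_ord -(cardsC A) addKn.
apply: eq_card => n; rewrite !inE /endpoint_design.
by case: ifP; rewrite ?eqxx// (negPf D_neq0).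
Qed.

Lemma mu2_endpoint_design D A : (0 < N)%N ->
  mu2 (endpoint_design D A) = D ^+ 2 * (#|A| * (N - #|A|))%:R / N%:R ^+ 2.
Proof.
move=> N_gt0; rewrite mu2E//; congr (_ / _).
have leAN : (#|A| <= N)%N by rewrite -[leqRHS]card_ord max_card.
have sumE (f : R -> R) : f 0 = 0 ->
    \sum_n f (endpoint_design D A n) = f D * #|A|%:R.
  move=> f0; rewrite mulr_natr -sumr_const [RHS]big_mkcond.
  by apply: eq_bigr => n _; rewrite /endpoint_design; case: ifP.
rewrite (sumE (fun x => x ^+ 2)) ?expr0n// (sumE id)//.
by rewrite natrM natrB//; ring.
Qed.

(** Induction on the number of interior positions: each move to an endpoint removes one of them and
    raises the variance. *)
Lemma mu2_le_endpoint_design D p : (1 < N)%N -> 0 < D -> deployment D p ->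
  exists A, mu2 p <= mu2 (endpoint_design D A).
Proof.
move=> N_gt1 D_gt0.
pose inner p := [set n | 0 < p n < D]%SET : {set 'I_N}.
have [k] := ubnP #|inner p|; elim: k p => // k IHk p.
have [inner0 _ pD|[n]] := set_0Vmem (inner p).
  exists [set n | p n == D]%SET; rewrite -at_endpointsE// => n.
  have : n \notin inner p by rewrite inner0 inE.
  rewrite inE => pn_notin.
  have := pD n; rewrite in_itv/= => /andP[p0 pleD].
  move: pn_notin; rewrite negb_and -!leNgt => /orP[ple0|Dlep].
    by left; apply/le_anti; rewrite ple0.
  by right; apply/le_anti; rewrite pleD.
rewrite inE ltnS => pn inner_le pD.
have [e eE lt_mu] := mu2_move_to_endpoint N_gt1 pn.
have [A leA] : exists A,
    mu2 [eta p with n |-> e] <= mu2 (endpoint_design D A).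
  apply: IHk => [|i] /=; last first.
    case: eqP => // _; rewrite in_itv/=.
    by case: eE => ->; rewrite lexx (ltW D_gt0).
  apply: (leq_trans _ inner_le); apply: proper_card.
  apply/properP; split.
    apply/fintype.subsetP => i; rewrite !inE /=; case: eqP => // _.
    by case: eE => ->; rewrite ltxx ?andbF.
  exists n; rewrite !inE//= eqxx.
  by case: eE => ->; rewrite ltxx ?andbF.
by exists A; exact: le_trans (ltW lt_mu) leA.
Qed.

Lemma mu2_singleton p : N = 1%N -> mu2 p = 0.
Proof.
move=> N1; subst N.
by rewrite /mu2 /mean !big_ord1 invr1 !mul1r subrr expr0n.
Qed.

(** No compactness argument is involved: the best of the finitely many endpoint designs dominates
    every design. *)
Lemma mu2_maximizer_exists D : (0 < N)%N -> 0 < D ->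
  exists2 p, is_maximizer (deployment D) (@mu2 R N) p & at_endpoints D p.
Proof.
move=> N_gt0 D_gt0.
pose A := [arg max_(A > (finset.set0 : {set 'I_N})) mu2 (endpoint_design D A)]%O.
exists (endpoint_design D A); last exact: at_endpoints_design.
split; first exact: endpoint_design_deployment.
(* A single element has variance 0 wherever it stands, so moving it gains nothing and this case is
   separate. *)
move=> p pD; have [N_gt1|N_le1] := ltnP 1 N; last first.
  by rewrite !mu2_singleton//; apply/eqP; rewrite eqn_leq N_le1.
have [B leB] := mu2_le_endpoint_design N_gt1 D_gt0 pD.
apply: le_trans leB _; rewrite /A; case: arg_maxP => // C _; exact.
Qed.

(** An interior position would allow a strictly better design, which is where strictness of the move
    matters. *)
Lemma mu2_maximizer_at_endpoints D p : (1 < N)%N -> 0 < D ->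
  is_maximizer (deployment D) (@mu2 R N) p -> at_endpoints D p.
Proof.
move=> N_gt1 D_gt0 [pD max_p] n.
have := pD n; rewrite in_itv/= => /andP[].
rewrite le_eqVlt => /predU1P[<-|pn_gt0]; first by left.
rewrite le_eqVlt => /predU1P[|pn_ltD]; first by right.
have [|e eE] := @mu2_move_to_endpoint D p n N_gt1; first by rewrite pn_gt0.
rewrite ltNge max_p// => i /=; case: eqP => // _.
by case: eE => ->; rewrite in_itv/= lexx (ltW D_gt0).
Qed.

Lemma mu2_maximizer_even D p : (0 < N)%N -> ~~ odd N -> 0 < D ->
  is_maximizer (deployment D) (@mu2 R N) p <->
  [/\ at_endpoints D p, multiplicity p 0 = N./2 & multiplicity p D = N./2].
Proof.
move=> N_gt0 evenN D_gt0; have D_neq0 : D != 0 by rewrite gt_eqF.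
have N_gt1 : (1 < N)%N by lia.
have leE A B : (mu2 (endpoint_design D A) <= mu2 (endpoint_design D B)) =
    (#|A| * (N - #|A|) <= #|B| * (N - #|B|))%N.
  rewrite !mu2_endpoint_design// ler_pM2r ?invr_gt0 ?exprn_gt0 ?ltr0n//.
  by rewrite ler_pM2l ?exprn_gt0// ler_nat.
split=> [max_p|[/at_endpointsE-> _]]; last first.
  rewrite multiplicity_design_r//; move: [set n | _]%SET => A cardA.
  split=> [|q qD]; first exact: endpoint_design_deployment.
  have [B leB] := mu2_le_endpoint_design N_gt1 D_gt0 qD.
  apply: le_trans leB _; rewrite leE cardA.
  have leBN : (#|B| <= N)%N by rewrite -[leqRHS]card_ord max_card.
  by case: (mul_subn_half _ _ evenN leBN).
have pE := mu2_maximizer_at_endpoints N_gt1 D_gt0 max_p.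
have [_ max_mu2] := max_p; move: max_mu2; rewrite (at_endpointsE pE).
move: [set n | _]%SET => A max_A.
have le_halfN : (N./2 <= N)%N by lia.
(* The first [N./2] indices serve as a competitor of balanced size; comparing with it forces
   equality in AM-GM for [A]. *)
pose H := [set widen_ord le_halfN i | i : 'I_(N./2)]%SET.
have cardH : #|H| = N./2.
  by rewrite card_imset ?card_ord// => i j [ij]; exact: val_inj.
have := max_A _ (endpoint_design_deployment H D_gt0); rewrite leE cardH => leA.
have leAN : (#|A| <= N)%N by rewrite -[leqRHS]card_ord max_card.
have cardA : #|A| = N./2.
  have geif_A := mul_subn_half _ _ evenN leAN.
  by apply/eqP; rewrite -geif_A.2 eqn_leq geif_A.1.
split; [exact: at_endpoints_design | |].
  by rewrite multiplicity_design_l// cardA; lia.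
by rewrite multiplicity_design_r.
Qed.

End Variance.

Theorem theorem6 (R : realType) (N Np : nat) (lambda D sigma2 Ps theta : R)
    (hN : (1 <= N)%N) (hNp : (1 <= Np)%N)
    (hlambda : 0 < lambda) (hD : 0 < D) (hsigma2 : 0 < sigma2) (hPs : 0 < Ps)
    (htheta : - (pi / 2) < theta < pi / 2) :
  let F := fisher_info (N := N) Np lambda sigma2 Ps theta in
  let optimal := D_optimal D (fisher_mx (N := N) Np lambda sigma2 Ps theta) in
  [/\ forall p, log_det (fisher_mx Np lambda sigma2 Ps theta p) = lne (F p)%:E,
      exists2 p, optimal p & at_endpoints D p,
      (2 <= N)%N -> forall p, optimal p -> at_endpoints D p,
      ~~ odd N -> forall p, optimal p <->
        [/\ at_endpoints D p, multiplicity p 0 = N./2 &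
            multiplicity p D = N./2] &
      forall p, optimal p -> is_maximizer (deployment D) F p].
Proof.
move=> F optimal.
(* The cosine is positive because [theta] lies in the open interval, so [F] is a positive multiple
   of [mu2]. *)
have c_gt0 : 0 < 8 * pi ^+ 2 * Np%:R * Ps * N%:R / (sigma2 * lambda ^+ 2)
    * cos theta ^+ 2.
  by rewrite !(mulr_gt0, invr_gt0, exprn_gt0, cos_gt0_pihalf, pi_gt0, ltr0n).
have F_ge0 p : 0 <= F p by rewrite mulr_ge0 ?mu2_ge0// ltW.
have leF p q : (F p <= F q) = (mu2 p <= mu2 q) by rewrite ler_pM2l.
have log_detE p : log_det (fisher_mx Np lambda sigma2 Ps theta p)
    = lne (F p)%:E by rewrite /log_det det_scalar1.
have optimalE p : optimal p <-> is_maximizer (deployment D) (@mu2 R N) p.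
  apply: eq_maximizers => q r.
  (* [lne] preserves and reflects the order on all of [[0, +oo]], so designs with zero information
     are compared correctly too. *)
  by rewrite !log_detE lee_lne ?lee_fin ?leF// in_itv/= lee_fin F_ge0 leey.
split=> //.
- have [p /optimalE max_p pE] := mu2_maximizer_exists hN hD.
  by exists p.
- by move=> N_gt1 p /optimalE; exact: mu2_maximizer_at_endpoints.
- move=> evenN p; rewrite optimalE; exact: mu2_maximizer_even.
- by move=> p /optimalE[pD max_p]; split=> // q qD; rewrite leF max_p.
Qed.
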